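(* Let $\Gamma$ be a planar network of rank $n$. Then $$\mathrm{im}(L\Gamma)\subset\overline{\mathcal{C}_2}\cap\{t^k_0=0\ \text{for } k=0,\dots,n\},$$ where the closure is taken in $\mathbb{T}^{VT}$.
   Context: A planar network consists of a finite graph $\Gamma$, reals $a<b$, and an embedding of $\Gamma$ in the strip $\{a\le x\le b\}$ with each edge a straight segment not parallel to the $y$-axis; vertices on $x=a$ are sources, on $x=b$ sinks, others internal; edges are oriented left to right, and a vertex has degree $(p,q)$ if it has $p$ incoming and $q$ outgoing edges. A multipath is a subgraph (same embedding) each of whose vertices that is internal in $\Gamma$ has degree $(1,1)$; a multipath with $k$ sources is a $k$-path, and $P_k\Gamma$ denotes the set of $k$-paths. $\mathbb{T}=\mathbb{R}\cup\{-\infty\}$. A weighting is $\epsilon\in\mathbb{T}^{E\Gamma}$; for a subgraph $\alpha$, $w_\alpha(\epsilon)=\sum_{e\in E\alpha}\epsilon(e)$ ($0$ if no edges). For $i>0$, $l_i\Gamma(\epsilon)=\max_{\alpha\in P_i\Gamma}w_\alpha(\epsilon)$ ($-\infty$ if $P_i\Gamma=\emptyset$) and $l_0\Gamma=0$. A planar network has rank $n$ if it has exactly $n$ sources and $n$ sinks and their $y$-coordinates are $\{1,\dots,n\}$. For $0\le k\le n$, $\Gamma^{(k)}$ is the maximal subgraph of $\Gamma$ not containing the vertices $(a,j),(b,j)$ with $j>k$ (a planar network of rank $k$). Let $VT=\{(k,i):0\le i\le k\le n\}$ with coordinates $t^k_i$; $L\Gamma:\mathbb{T}^{E\Gamma}\to\mathbb{T}^{VT}$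 is given by $t^k_i=l_i\Gamma^{(k)}$. $\mathcal{C}_2\subset\mathbb{R}^{VT}$ is the cone defined by $t^{k+1}_{i}+t^{k}_{i-1}\ge t^{k+1}_{i-1}+t^{k}_{i}$ and $t^{k+1}_{i}+t^{k}_{i}\ge t^{k+1}_{i+1}+t^{k}_{i-1}$ for $0<i\le k<n$; $\mathbb{T}$ carries the topology of $[-\infty,\infty)$.
   Formalization: In a multipath, besides internal vertices having degree (1,1), sources must have degree (0,1) and sinks (1,0), so a k-path is k disjoint source-to-sink paths; without this the claim fails, e.g. for n=2 with edges s1→k1, s1→k2, s2→k2 of weights 0,1,1. *)

(* Defs.v *)
From HB Require Import structures.
From mathcomp Require Import all_boot all_order all_algebra.
From mathcomp Require Import all_classical all_reals all_analysis.

Set Implicit Arguments.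
Unset Strict Implicit.
Unset Printing Implicit Defensive.

Import Order.TTheory GRing.Theory Num.Theory.
Local Open Scope classical_set_scope.
Local Open Scope ring_scope.

(* The tropical line [-oo, +oo[, with the topology induced by that of \bar R. *)
Definition trop (R : realType) : topologicalType :=
  set_type [set x : \bar R | (x < +oo)%E].

Definition trop_val (R : realType) (x : trop R) : \bar R := set_val x.

Definition Trop (R : realType) (x : \bar R) (hx : (x < +oo)%E) : trop R :=
  SigSub (mem_set hx : x \in [set y : \bar R | (y < +oo)%E]).

Definition trop_of_real (R : realType) (r : R) : trop R := Trop (ltry r).

Lemma trop_val_lty (R : realType) (x : trop R) : (trop_val x < +oo)%E.
Proof. by case: x => x /= hx; exact: (set_mem hx). Qed.

Definition segment (R : realType) (p q : R * R) : set (R * R) :=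
  [set z | exists2 t : R, 0 <= t <= 1 &
    z = ((1 - t) * p.1 + t * q.1, (1 - t) * p.2 + t * q.2)].

(* Vertices are points of the strip and edges are straight segments, so an
   embedding is given by the positions of the vertices.  [pn_vertex_edge] and
   [pn_edge_edge] say that the drawing is injective: an edge meets no vertices
   but its endpoints, and two edges meet only at common endpoints (so that
   there are no parallel edges).  [pn_edge_lr] both excludes vertical edges and
   fixes the left to right orientation. *)
Record planar_network (R : realType) := PlanarNetwork {
  pn_vertex : finType;
  pn_edge : finType;
  pn_src : pn_edge -> pn_vertex;
  pn_tgt : pn_edge -> pn_vertex;
  pn_a : R;
  pn_b : R;
  pn_pos : pn_vertex -> R * R;
  pn_ab : pn_a < pn_b;
  pn_strip : forall v, pn_a <= (pn_pos v).1 <= pn_b;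
  pn_edge_lr : forall e, (pn_pos (pn_src e)).1 < (pn_pos (pn_tgt e)).1;
  pn_pos_inj : injective pn_pos;
  pn_vertex_edge : forall v e,
    segment (pn_pos (pn_src e)) (pn_pos (pn_tgt e)) (pn_pos v) ->
    v = pn_src e \/ v = pn_tgt e;
  pn_edge_edge : forall e f z, e <> f ->
    segment (pn_pos (pn_src e)) (pn_pos (pn_tgt e)) z ->
    segment (pn_pos (pn_src f)) (pn_pos (pn_tgt f)) z ->
    exists v, [/\ z = pn_pos v, v = pn_src e \/ v = pn_tgt e
                & v = pn_src f \/ v = pn_tgt f] }.

Section Network.
Variables (R : realType) (G : planar_network R).

Let V := pn_vertex G.
Let E := pn_edge G.

Definition is_source (v : V) : bool := (pn_pos v).1 == pn_a G.
Definition is_sink (v : V) : bool := (pn_pos v).1 == pn_b G.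

Definition has_rank (n : nat) : Prop :=
  [/\ #|[set v : V | is_source v]%SET| = n,
      #|[set v : V | is_sink v]%SET| = n,
      [set (pn_pos v).2 | v in [set v : V | is_source v]]
        = [set j%:R | j in [set j : nat | (1 <= j <= n)%N]]
    & [set (pn_pos v).2 | v in [set v : V | is_sink v]]
        = [set j%:R | j in [set j : nat | (1 <= j <= n)%N]] ].

(* A pair (vertices, edges), which is a subgraph when [is_subgraph] holds. *)
Definition graph_part : Type := ({set V} * {set E})%type.

Definition is_subgraph (s : graph_part) : bool :=
  [forall e in s.2, (pn_src e \in s.1) && (pn_tgt e \in s.1)].

Definition part_le (s s' : graph_part) : bool :=
  (s.1 \subset s'.1) && (s.2 \subset s'.2).

Definition whole : graph_part := ([set: V]%SET, [set: E]%SET).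

Definition degree (s : graph_part) (v : V) : nat * nat :=
  (#|[set e in s.2 | pn_tgt e == v]%SET|, #|[set e in s.2 | pn_src e == v]%SET|).

(* Multipaths are disjoint unions of paths from a source to a sink: the
   condition at internal vertices alone would allow a source to have no or
   several outgoing edges, and would make a multipath of every network without
   internal vertices. *)
Definition is_multipath (s : graph_part) : bool :=
  is_subgraph s &&
  [forall v in s.1, degree s v ==
     (if is_source v then (0, 1)%N else if is_sink v then (1, 0)%N
      else (1, 1)%N)].

Definition num_sources (s : graph_part) : nat :=
  #|[set v in s.1 | is_source v]%SET|.

Definition kpaths (s : graph_part) (k : nat) : {set graph_part} :=
  [set p : graph_part | [&& is_multipath p, part_le p s & num_sources p == k]]%SET.

Definition weight (eps : E -> trop R) (p : graph_part) : \bar R :=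
  (\sum_(e in p.2) trop_val (eps e))%E.

Definition lval (s : graph_part) (i : nat) (eps : E -> trop R) : \bar R :=
  if i == 0%N then 0%E
  else \big[maxe/-oo%E]_(p in kpaths s i) weight eps p.

Lemma weight_lty eps p : (weight eps p < +oo)%E.
Proof. by apply: lte_sum_pinfty => e _; exact: trop_val_lty. Qed.

Lemma lval_lty s i eps : (lval s i eps < +oo)%E.
Proof.
rewrite /lval; case: ifP => _; first exact: ltry.
elim/big_ind: _ => //; first by move=> x y hx hy; rewrite gt_max hx hy.
by move=> p _; exact: weight_lty.
Qed.

Definition trunc_vertex (k : nat) (v : V) : bool :=
  ~~ `[< exists2 j : nat, (k < j)%N &
           pn_pos v = (pn_a G, j%:R) \/ pn_pos v = (pn_b G, j%:R) >].

Definition trunc (k : nat) : graph_part :=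
  ([set v : V | trunc_vertex k v]%SET,
   [set e : E | trunc_vertex k (pn_src e) && trunc_vertex k (pn_tgt e)]%SET).

Lemma trunc_subgraph k : is_subgraph (trunc k).
Proof. by apply/forall_inP => e; rewrite !inE. Qed.

Lemma trunc_maximal k s : is_subgraph s ->
  (forall v, v \in s.1 -> trunc_vertex k v) -> part_le s (trunc k).
Proof.
move=> /forall_inP sub sv; apply/andP; split; apply/fintype.subsetP => x xs.
  by rewrite inE sv.
by case/andP: (sub x xs) => xs1 xs2; rewrite inE !sv.
Qed.

End Network.

(* Pairs (k, i) with 0 <= i <= k <= n. *)
Definition VT (n : nat) : Type := {p : nat * nat | (p.2 <= p.1 <= n)%N}.

(* [t]^k_i ; the default value is only used for (k, i) outside of VT. *)
Definition coord (R : realType) (n : nat) (t : VT n -> R) (k i : nat) : R :=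
  oapp t 0 (insub (k, i)).

Definition tropVT (R : realType) (n : nat) : topologicalType :=
  prod_topology (fun _ : VT n => trop R).

Definition Lmap (R : realType) (n : nat) (G : planar_network R)
    (eps : pn_edge G -> trop R) : tropVT R n :=
  fun p : VT n => Trop (lval_lty (trunc G (val p).1) (val p).2 eps).

Definition cone2 (R : realType) (n : nat) : set (VT n -> R) :=
  [set t | forall k i : nat, (0 < i)%N -> (i <= k)%N -> (k < n)%N ->
     coord t k.+1 i + coord t k i.-1 >= coord t k.+1 i.-1 + coord t k i /\
     coord t k.+1 i + coord t k i >= coord t k.+1 i.+1 + coord t k i.-1].

Definition trop_embed (R : realType) (n : nat) (t : VT n -> R) : tropVT R n :=
  fun p : VT n => trop_of_real (t p).

Definition zero_section (R : realType) (n : nat) : set (tropVT R n) :=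
  [set t | forall p : VT n, (val p).2 = 0%N -> t p = trop_of_real 0].

(* Main.v *)
(* Superimpose two multipaths, one in Gamma^(k+1) and the other in Gamma^(k), and
   sort the heights of their N paths pointwise: by planarity the sorted heights
   again run along edges, and give weakly non-crossing paths r_0 >= r_1 >= ... .
   No point lies on more than two of them, so r_0, r_2, ... are disjoint and so are
   r_1, r_3, ...; the latter avoid the endpoints of height k+1, which can only lie
   on r_0.  This replaces (i, j) by (ceil(N/2), floor(N/2)) paths of the same total
   weight, which yields both families of inequalities over T.  Dropping r_0 from a
   single multipath shows that {i : t^k_i finite} is an initial segment.

   In terms of x^k_i = t^k_i - t^k_{i-1} the inequalities say that x is a
   Gelfand-Tsetlin pattern with entries in T; replacing x by max(x, -N) gives real
   points of the cone that converge to t as N tends to infinity. *)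
Require Import Defs.
From mathcomp Require Import all_boot all_order all_algebra.
From mathcomp Require Import all_classical all_reals all_analysis.
From mathcomp Require Import ring lra.

Local Open Scope classical_set_scope.

Set Implicit Arguments.
Unset Strict Implicit.
Unset Printing Implicit Defensive.

Import Order.TTheory GRing.Theory Num.Theory.
Local Open Scope ring_scope.

(** * Planar geometry of edges *)

(* Sorted by decreasing [y], the items tile the ranks from [u] on, item [t]
   occupying [c t] consecutive ones. *)
Lemma sum_count_rank (R : realType) (T : finType) (P : {set T}) (y : T -> R)
    (c : T -> nat) (S : pred nat) (u : nat) : {in P &, injective y} ->
  (\sum_(t in P) count S (iota (u + \sum_(s in P | (y t < y s)%R) c s) (c t)) =
   count S (iota u (\sum_(t in P) c t)))%N.
Proof.
move: {2}#|P| (erefl #|P|) => k; elim: k P => [|k IH] P.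
  by move/eqP; rewrite cards_eq0 => /eqP-> _; rewrite !big_set0.
move=> cardP inj.
have /set0Pn[i0 i0P] : P != finset.set0 by rewrite -card_gt0 cardP.
(* The lowest item occupies the last block of ranks, so removing it shifts no other block. *)
case: (arg_minP y i0P) => t0 t0P0 min0; have t0P : t0 \in P := t0P0.
have lt0 s : s \in P :\ t0 -> (y t0 < y s)%R.
  case/setD1P=> sD sP; rewrite lt_neqAle min0 // andbT.
  by apply: contra sD => /eqP/(inj _ _ t0P sP)->.
rewrite (big_setD1 t0) //= [in RHS](big_setD1 t0) //= [in RHS]addnC iotaD count_cat.
rewrite -[in X in _ = (X + _)%N]IH; first last.
- by move=> ? ? /setD1P[_ ?] /setD1P[_ ?]; exact: inj.
- by move: cardP; rewrite (cardsD1 t0) t0P => -[].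
rewrite addnC; congr (_ + count S (iota (u + _) _))%N.
  apply: eq_bigr => t tP; congr (count S (iota (u + _) _)).
  apply: eq_bigl => s; rewrite !inE; case: (eqVneq s t0) => //= ->.
  by rewrite ltNge (ltW (lt0 _ tP)) andbF.
apply: eq_bigl => s; rewrite !inE; case: (eqVneq s t0) => /= [->|sD].
  by rewrite ltxx andbF.
case sP: (s \in P) => //=; apply: lt0; by rewrite !inE sD.
Qed.

Lemma card_pos_mult (T : finType) (P : pred T) (c : T -> nat) :
  (forall t, (c t <= 1)%N) ->
  #|[set t in [set t | (0 < c t)%N]%SET | P t]%SET| = (\sum_(t | P t) c t)%N.
Proof.
move=> c1; rewrite -sum1dep_card [RHS](bigID (fun t => 0 < c t)%N) /=.
rewrite [X in _ = (_ + X)%N]big1 => [|t /andP[_]]; last by rewrite -eqn0Ngt => /eqP.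
rewrite addn0; apply: eq_big => t; first by rewrite inE andbC.
by rewrite inE => /andP[h _]; apply/eqP; rewrite eqn_leq h c1.
Qed.

Lemma card_set_cond (T : finType) (A : {set T}) (P : pred T) :
  #|[set t in A | P t]%SET| = (\sum_(t | P t) (t \in A))%N.
Proof.
rewrite -sum1dep_card big_mkcondl /=; apply: eq_bigr => t _.
by case: (t \in A).
Qed.

Section Geometry.
Variables (R : realType) (G : planar_network R).

Notation V := (pn_vertex G).
Notation E := (pn_edge G).
Notation src := (@pn_src R G).
Notation tgt := (@pn_tgt R G).
Notation px v := (pn_pos v).1.
Notation py v := (pn_pos v).2.

Implicit Types (e f : E) (v w : V).

Definition slope e : R := (py (tgt e) - py (src e)) / (px (tgt e) - px (src e)).

Definition height e (x : R) : R := py (src e) + slope e * (x - px (src e)).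

Definition spans e (x : R) : bool := px (src e) <= x <= px (tgt e).

Lemma height_src e : height e (px (src e)) = py (src e).
Proof. by rewrite /height subrr mulr0 addr0. Qed.

Lemma height_tgt e : height e (px (tgt e)) = py (tgt e).
Proof.
rewrite /height /slope divfK ?subrKC // subr_eq0.
by rewrite gt_eqF // pn_edge_lr.
Qed.

Lemma height_affine e (x x' : R) :
  height e x' = height e x + slope e * (x' - x).
Proof. rewrite /height; ring. Qed.

Lemma height_segment e x : spans e x ->
  segment (pn_pos (src e)) (pn_pos (tgt e)) (x, height e x).
Proof.
case/andP=> h1 h2; have := pn_edge_lr e; rewrite -subr_gt0 => lr.
exists ((x - px (src e)) / (px (tgt e) - px (src e))).
  by rewrite divr_ge0 ?subr_ge0 ?(ltW lr)//= ?ler_pdivrMr // ?mul1r ?lerB // -subr_ge0 ltW.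
rewrite /height /slope; congr pair; field; exact: lt0r_neq0.
Qed.

Lemma vertex_on_edge v e : spans e (px v) -> height e (px v) = py v ->
  v = src e \/ v = tgt e.
Proof.
move=> sp hv; apply: pn_vertex_edge.
by have := height_segment sp; rewrite hv -surjective_pairing.
Qed.

Lemma heights_meet_at_vertex e f x : e <> f -> spans e x -> spans f x ->
  height e x = height f x ->
  exists v, [/\ x = px v, v = src e \/ v = tgt e & v = src f \/ v = tgt f].
Proof.
move=> ef se sf hef.
have := height_segment sf; rewrite -hef => sf'.
have [v [zv ve vf]] := pn_edge_edge ef (height_segment se) sf'.
by exists v; rewrite -zv.
Qed.

(** A meeting point would be an endpoint of [e], which the strict bounds on [x] exclude. *)
Lemma height_neq e f x : e <> f -> px (src e) < x < px (tgt e) -> spans f x ->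
  height e x != height f x.
Proof.
move=> ef /andP[s1 s2] sf; apply/eqP => hef.
have se : spans e x by rewrite /spans !ltW.
have [v [xv [] ve _]] := heights_meet_at_vertex ef se sf hef.
  by rewrite xv ve ltxx in s1.
by rewrite xv ve ltxx in s2.
Qed.

(** The difference of heights is affine; a strict change of sign gives a zero strictly between [x]
    and [x'], hence inside [e], against [height_neq]. The conclusion is only weak because the edges
    may share an endpoint at [x']. *)
Lemma height_le e f x x' : e <> f -> spans e x -> spans f x ->
  spans e x' -> spans f x' ->
  height e x < height f x -> height e x' <= height f x'.
Proof.
move=> ef sex sfx sex' sfx' lt1; rewrite leNgt; apply/negP => lt2.
set g := height f x - height e x; set g' := height e x' - height f x'.
have g0 : 0 < g by rewrite subr_gt0.
have g0' : 0 < g' by rewrite subr_gt0.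
(* The zero of the affine function with values [g] at [x] and [- g'] at [x']. *)
set z := (g' * x + g * x') / (g + g').
have gg : 0 < g + g' by apply: addr_gt0.
have xx' : x != x'.
  by apply: contraTneq lt2 => <-; rewrite -leNgt ltW.
have bet (p q : R) : p <= x <= q -> p <= x' <= q -> p < z < q.
  move=> /andP[p1 p2] /andP[q1 q2]; rewrite /z ltr_pdivlMr // ltr_pdivrMr //.
  rewrite -[p * _ < _]subr_gt0 -[_ < q * _]subr_gt0.
  have -> : g' * x + g * x' - p * (g + g') = g' * (x - p) + g * (x' - p) by ring.
  have -> : q * (g + g') - (g' * x + g * x') = g' * (q - x) + g * (q - x') by ring.
  have H (u v : R) : 0 <= u -> 0 <= v -> u != v -> 0 < g' * u + g * v.
    move=> u0 v0 uv; move: u0 uv; rewrite le_eqVlt => /orP[/eqP<-|u0] uv.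
      by rewrite mulr0 add0r mulr_gt0 // lt_neqAle uv.
    by rewrite ltr_pwDl ?mulr_gt0 // mulr_ge0 // ltW.
  rewrite !H ?subr_ge0 //; apply: contra xx' => /eqP h; apply/eqP; lra.
have bz : px (src e) < z < px (tgt e) by apply: bet.
have fz : spans f z.
  by case/andP: (bet _ _ sfx sfx') => h1 h2; rewrite /spans !ltW.
have /eqP := height_neq ef bz fz; apply.
have gE : g' = - g + (slope e - slope f) * (x' - x).
  by rewrite /g' (height_affine e x) (height_affine f x) /g; ring.
rewrite (height_affine e x) (height_affine f x); apply/eqP; rewrite -subr_eq0.
have -> : z - x = g * (x' - x) / (g + g') by rewrite /z; field; exact: lt0r_neq0.
have -> : height e x + slope e * (g * (x' - x) / (g + g')) -
  (height f x + slope f * (g * (x' - x) / (g + g')))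
  = - g + g * ((slope e - slope f) * (x' - x)) / (g + g').
  by rewrite /g; field; exact: lt0r_neq0.
have -> : (slope e - slope f) * (x' - x) = g + g' by rewrite gE; ring.
by rewrite mulfK ?addNr // lt0r_neq0.
Qed.

Definition overlap e f : bool :=
  Num.max (px (src e)) (px (src f)) < Num.min (px (tgt e)) (px (tgt f)).

Definition overlap_mid e f : R :=
  (Num.max (px (src e)) (px (src f)) + Num.min (px (tgt e)) (px (tgt f))) / 2.

(** The midpoint of the common range avoids shared endpoints, the only places where distinct edges
    can tie. By [above_at] any other common abscissa without a tie gives the same answer. *)
Definition above f e : bool :=
  height e (overlap_mid e f) < height f (overlap_mid e f).

Lemma aboveNN e : above e e = false.
Proof. exact: ltxx. Qed.

Lemma overlap_midP e f : overlap e f ->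
  (px (src e) < overlap_mid e f < px (tgt e)) /\
  (px (src f) < overlap_mid e f < px (tgt f)).
Proof.
rewrite /overlap /overlap_mid => h.
have [h1 h2] := midf_lt h.
by move: h1 h2; rewrite gt_max lt_min => /andP[-> ->] /andP[-> ->].
Qed.

Lemma above_at e f x : e <> f -> overlap e f -> spans e x -> spans f x ->
  height e x != height f x -> above f e = (height e x < height f x).
Proof.
move=> ef ov se sf hx; have [me mf] := overlap_midP ov.
have mf' : spans f (overlap_mid e f) by case/andP: mf => ? ?; rewrite /spans !ltW.
have me' : spans e (overlap_mid e f) by case/andP: me => ? ?; rewrite /spans !ltW.
have hm := height_neq ef me mf'.
apply/idP/idP => h.
  by rewrite lt_neqAle hx; apply: (height_le ef me' mf' se sf h).
by rewrite /above lt_neqAle hm; apply: (height_le ef se sf me' mf' h).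
Qed.

Lemma overlap_src e f : src e = src f -> overlap e f.
Proof. by move=> h; rewrite /overlap h maxxx lt_min -{1}h !pn_edge_lr. Qed.

Lemma overlap_tgt e f : tgt e = tgt f -> overlap e f.
Proof. by move=> h; rewrite /overlap h minxx gt_max -{1}h !pn_edge_lr. Qed.

Lemma above_src e f : src e = src f -> above f e = (slope e < slope f).
Proof.
move=> h; have [/andP[s1 _] _] := overlap_midP (overlap_src h).
by rewrite /above /height -h ltrD2l ltr_pM2r // subr_gt0.
Qed.

Lemma above_tgt e f : tgt e = tgt f -> above f e = (slope f < slope e).
Proof.
move=> h; have [/andP[_ s1] _] := overlap_midP (overlap_tgt h).
rewrite /above (height_affine e (px (tgt e))) (height_affine f (px (tgt f))).
by rewrite !height_tgt -h ltrD2l ltr_nM2r // subr_lt0.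
Qed.

Lemma slope_src_inj e f : src e = src f -> slope e = slope f -> e = f.
Proof.
move=> h hs; apply/eqP/negPn/negP => /eqP ef.
have [me /andP[s1 s2]] := overlap_midP (overlap_src h).
have mf : spans f (overlap_mid e f) by rewrite /spans !ltW.
by have := height_neq ef me mf; rewrite /height h hs eqxx.
Qed.

Lemma slope_tgt_inj e f : tgt e = tgt f -> slope e = slope f -> e = f.
Proof.
move=> h hs; apply/eqP/negPn/negP => /eqP ef.
have [me /andP[s1 s2]] := overlap_midP (overlap_tgt h).
have mf : spans f (overlap_mid e f) by rewrite /spans !ltW.
have := height_neq ef me mf.
by rewrite (height_affine e (px (tgt e))) (height_affine f (px (tgt f))) !height_tgt h hs eqxx.
Qed.

Lemma src_not_sink e : ~~ is_sink (src e).
Proof.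
rewrite /is_sink lt_eqF //; apply: (lt_le_trans (pn_edge_lr e)).
by case/andP: (pn_strip (tgt e)).
Qed.

Lemma tgt_not_source e : ~~ is_source (tgt e).
Proof.
rewrite /is_source gt_eqF //; apply: le_lt_trans (pn_edge_lr e).
by case/andP: (pn_strip (src e)).
Qed.

Lemma source_not_sink v : is_source v -> ~~ is_sink v.
Proof. by move/eqP=> h; rewrite /is_sink h lt_eqF // pn_ab. Qed.

Lemma not_sink_lt v : px v < pn_b G -> ~~ is_sink v.
Proof. by move=> h; rewrite /is_sink lt_eqF. Qed.

Lemma not_source_gt v : pn_a G < px v -> ~~ is_source v.
Proof. by move=> h; rewrite /is_source gt_eqF. Qed.

Lemma source_gt v : ~~ is_source v -> pn_a G < px v.
Proof. by rewrite /is_source lt_neqAle eq_sym => ->; case/andP: (pn_strip v). Qed.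

Lemma sink_lt v : ~~ is_sink v -> px v < pn_b G.
Proof. by rewrite /is_sink lt_neqAle => ->; case/andP: (pn_strip v). Qed.

End Geometry.

(** * Sorting superimposed paths by height *)

Section Flow.
Variables (R : realType) (G : planar_network R).

Notation V := (pn_vertex G).
Notation E := (pn_edge G).
Notation src := (@pn_src R G).
Notation tgt := (@pn_tgt R G).
Notation px v := (pn_pos v).1.
Notation py v := (pn_pos v).2.

Implicit Types (e f : E) (v w : V).

Variables (d : V -> nat) (m : E -> nat).
Hypothesis inflow : forall v, ~~ is_source v ->
  (\sum_(e | tgt e == v) m e = d v)%N.
Hypothesis outflow : forall v, ~~ is_sink v ->
  (\sum_(e | src e == v) m e = d v)%N.

Lemma sum_by_src (P : pred V) : (forall v, P v -> ~~ is_sink v) ->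
  (\sum_(e | P (src e)) m e = \sum_(v | P v) d v)%N.
Proof.
move=> hP; rewrite (partition_big src P) //=; apply: eq_bigr => v Pv.
rewrite -outflow ?hP //; apply: eq_bigl => e.
by case: eqP => [->|]; rewrite ?Pv // andbF.
Qed.

Lemma sum_by_tgt (P : pred V) : (forall v, P v -> ~~ is_source v) ->
  (\sum_(e | P (tgt e)) m e = \sum_(v | P v) d v)%N.
Proof.
move=> hP; rewrite (partition_big tgt P) //=; apply: eq_bigr => v Pv.
rewrite -inflow ?hP //; apply: eq_bigl => e.
by case: eqP => [->|]; rewrite ?Pv // andbF.
Qed.

(* Think of [d] and [m] as the multiplicities of a family of paths: the ranks
   below count the paths passing strictly above [v], resp. [e], just to the right
   of [v] or just to its left. *)
Definition rank_out v : nat := (\sum_(f | (px (src f) <= px v < px (tgt f))%R &&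
  (py v < height f (px v))%R) m f)%N.

Definition rank_in v : nat := (\sum_(f | (px (src f) < px v <= px (tgt f))%R &&
  (py v < height f (px v))%R) m f)%N.

(** No edge continues to the right of a sink or to the left of a source, so each of them has only
    one meaningful rank; elsewhere the two agree by [rank_in_out]. *)
Definition vertex_rank v : nat := if is_sink v then rank_in v else rank_out v.

Definition edge_rank e : nat :=
  (\sum_(f | (px (src f) <= px (src e) < px (tgt f))%R && above f e) m f)%N.

Definition edge_rank_end e : nat :=
  (\sum_(f | (px (src f) < px (tgt e) <= px (tgt f))%R && above f e) m f)%N.

(** An edge present just to the right of [x = a] starts on that line, at the height of its
    source. *)
Lemma rank_out_source v : is_source v ->
  (rank_out v = \sum_(w | is_source w && (py v < py w)%R) d w)%N.
Proof.
move=> sv; rewrite -(@sum_by_src (fun w => is_source w && (py v < py w)%R)).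
  apply: eq_bigl => f; have va : px v = pn_a G by exact/eqP.
  rewrite va (source_gt (tgt_not_source f)) andbT.
  have -> : (px (src f) <= pn_a G) = is_source (src f).
    by rewrite /is_source eq_le; case/andP: (pn_strip (src f)) => -> _; rewrite andbT.
  by case sf: (is_source (src f)) => //=; rewrite -(eqP sf) height_src.
by move=> w /andP[/source_not_sink].
Qed.

Lemma rank_in_sink v : is_sink v ->
  (rank_in v = \sum_(w | is_sink w && (py v < py w)%R) d w)%N.
Proof.
move=> sv; rewrite -(@sum_by_tgt (fun w => is_sink w && (py v < py w)%R)).
  apply: eq_bigl => f; have va : px v = pn_b G by exact/eqP.
  rewrite va (sink_lt (src_not_sink f)) /=.
  have -> : (pn_b G <= px (tgt f)) = is_sink (tgt f).
    by rewrite /is_sink eq_le; case/andP: (pn_strip (tgt f)) => _ ->.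
  by case sf: (is_sink (tgt f)) => //=; rewrite -(eqP sf) height_tgt.
by move=> w /andP[sw _]; apply: contraL sw => /source_not_sink.
Qed.

(** Edges crossing the vertical line through [v] in their interior count on both sides. Those ending
    on it above [v] are balanced by those starting there, by conservation at these vertices. *)
Lemma rank_in_out v : ~~ is_source v -> ~~ is_sink v -> rank_in v = rank_out v.
Proof.
move=> nso nsi; have va := source_gt nso; have vb := sink_lt nsi.
pose P w := (px w == px v) && (py v < py w)%R.
have Psi w : P w -> ~~ is_sink w by case/andP=> /eqP wv _; rewrite not_sink_lt ?wv.
have Pso w : P w -> ~~ is_source w by case/andP=> /eqP wv _; rewrite not_source_gt ?wv.
rewrite /rank_in (bigID (fun f => P (tgt f))) /=.
rewrite /rank_out [in RHS](bigID (fun f => P (src f))) /=; congr (_ + _)%N.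
  rewrite (_ : (\sum_(_ | _) _)%N = (\sum_(f | P (tgt f)) m f)%N).
    rewrite sum_by_tgt // -sum_by_src //; apply: eq_bigl => f.
    case Pf: (P _); rewrite ?andbF // andbT; case/andP: Pf => /eqP fv fy.
    by rewrite -fv lexx pn_edge_lr /= height_src.
  apply: eq_bigl => f.
  case Pf: (P _); rewrite ?andbF // andbT; case/andP: Pf => /eqP fv fy.
  by rewrite -fv lexx pn_edge_lr /= height_tgt.
apply: eq_bigl => f; rewrite /P.
case: (eqVneq (px (tgt f)) (px v)) => [ft|ft] /=.
  rewrite -ft height_tgt ltxx lexx !andbF /=.
  by case: (py v < _) => //=; rewrite !andbF.
rewrite [px v <= _]le_eqVlt eq_sym (negbTE ft) /= andbT.
case: (eqVneq (px (src f)) (px v)) => [fs|fs] /=.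
  by rewrite -fs height_src ltxx /= -andbA andbN andbF.
by rewrite andbT [px (src f) <= _]le_eqVlt (negbTE fs).
Qed.

Lemma vertex_rank_src e : vertex_rank (src e) = rank_out (src e).
Proof. by rewrite /vertex_rank (negbTE (src_not_sink e)). Qed.

Lemma vertex_rank_tgt e : vertex_rank (tgt e) = rank_in (tgt e).
Proof.
rewrite /vertex_rank; case: ifPn => // ns.
by rewrite rank_in_out // tgt_not_source.
Qed.

(** Just to the right of [src e], an edge above [e] either passes strictly above that vertex or
    leaves it with a larger slope. *)
Lemma edge_rank_src e : (edge_rank e =
  vertex_rank (src e) + \sum_(f | (src f == src e) && (slope e < slope f)%R) m f)%N.
Proof.
rewrite vertex_rank_src /edge_rank (bigID (fun f => src f == src e)) /= addnC.
congr (_ + _)%N; apply: eq_bigl => f; last first.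
  case: eqVneq => [fe|_]; rewrite ?andbF // andbT /= fe lexx -fe pn_edge_lr /=.
  by rewrite above_src.
case: (eqVneq e f) => [<-|/eqP ef]; first by rewrite aboveNN eqxx height_src ltxx !andbF.
case H: (_ <= _ < _); rewrite ?andbF //=.
case/andP: H => f1 f2.
have ov : overlap e f.
  by rewrite /overlap gt_max !lt_min pn_edge_lr f2 pn_edge_lr (le_lt_trans f1 (pn_edge_lr e)).
have se : spans e (px (src e)) by rewrite /spans lexx ltW // pn_edge_lr.
have sf : spans f (px (src e)) by rewrite /spans f1 ltW.
case: (eqVneq (src f) (src e)) => [fe|/eqP fe] /=.
  by rewrite andbF -fe height_src ltxx.
rewrite andbT (above_at ef ov se sf); rewrite height_src //.
(* If [f] passed through [src e], that vertex would be an endpoint of [f]: not its source by [fe],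
   nor its target, which lies further right. *)
apply/eqP => h; case: (vertex_on_edge sf (esym h)) => h'; first exact: fe.
by rewrite h' ltxx in f2.
Qed.

Lemma edge_rank_endE e : (edge_rank_end e =
  vertex_rank (tgt e) + \sum_(f | (tgt f == tgt e) && (slope f < slope e)%R) m f)%N.
Proof.
rewrite vertex_rank_tgt /edge_rank_end (bigID (fun f => tgt f == tgt e)) /= addnC.
congr (_ + _)%N; apply: eq_bigl => f; last first.
  case: eqVneq => [fe|_]; rewrite ?andbF // andbT /= fe lexx -fe pn_edge_lr /=.
  by rewrite above_tgt.
case: (eqVneq e f) => [<-|/eqP ef]; first by rewrite aboveNN eqxx height_tgt ltxx !andbF.
case H: (_ < _ <= _); rewrite ?andbF //=.
case/andP: H => f1 f2.
have ov : overlap e f.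
  by rewrite /overlap gt_max !lt_min pn_edge_lr f1 pn_edge_lr (lt_le_trans (pn_edge_lr e) f2).
have se : spans e (px (tgt e)) by rewrite /spans lexx ltW // pn_edge_lr.
have sf : spans f (px (tgt e)) by rewrite /spans f2 ltW.
case: (eqVneq (tgt f) (tgt e)) => [fe|/eqP fe] /=.
  by rewrite andbF -fe height_tgt ltxx.
rewrite andbT (above_at ef ov se sf); rewrite height_tgt //.
apply/eqP => h; case: (vertex_on_edge sf (esym h)) => h'; last exact: fe.
by rewrite h' ltxx in f1.
Qed.

(* Both sides count the edges above [e] that overlap it, minus those that start
   (resp. end) at a vertex lying strictly above the interior of [e]; by flow
   conservation at these vertices the corrections agree. *)
Lemma edge_rank_endP e : edge_rank e = edge_rank_end e.
Proof.
pose F f := [&& px (src f) < px (tgt e), px (src e) < px (tgt f) & above f e].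
pose P v := [&& px (src e) < px v, px v < px (tgt e) & height e (px v) < py v].
have Psi w : P w -> ~~ is_sink w.
  case/and3P=> _ we _; apply: not_sink_lt; apply: lt_le_trans we _.
  by case/andP: (pn_strip (tgt e)).
have Pso w : P w -> ~~ is_source w.
  case/and3P=> we _ _; apply: not_source_gt; apply: le_lt_trans we.
  by case/andP: (pn_strip (src e)).
(* An endpoint of [f] with abscissa strictly inside the range of [e] is not on [e], so [above] can
   be tested there. *)
have abv f v : px (src e) < px v < px (tgt e) -> v = src f \/ v = tgt f ->
    px (src f) < px (tgt e) -> px (src e) < px (tgt f) ->
    above f e = (height e (px v) < py v).
  move=> /andP[v1 v2] vf f1 f2.
  have hv : height f (px v) = py v by case: vf => ->; rewrite ?height_src ?height_tgt.
  have se : spans e (px v) by rewrite /spans !ltW.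
  have ne : height e (px v) != height f (px v).
    rewrite hv; apply/eqP => h; case: (vertex_on_edge se h) => h'.
      by rewrite h' ltxx in v1.
    by rewrite h' ltxx in v2.
  have sf : spans f (px v).
    by case: vf => ->; rewrite /spans lexx ltW // pn_edge_lr.
  rewrite -hv; apply: above_at => //.
    by move=> ef; rewrite ef eqxx in ne.
  by rewrite /overlap gt_max !lt_min !pn_edge_lr f1 f2.
have start : (\sum_(f | F f) m f = edge_rank e + \sum_(v | P v) d v)%N.
  rewrite -sum_by_src // (bigID (fun f => P (src f))) /= addnC.
  congr (_ + _)%N; apply: eq_bigl => f; last first.
    case Pf: (P _); rewrite ?andbF // andbT /F; case/and3P: Pf => p1 p2 p3.
    have f2 := lt_trans p1 (pn_edge_lr f).
    by rewrite p2 f2 /= (@abv f (src f)) ?p1 ?p2 //; left.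
  rewrite /F; case: (ltP (px (src e)) (px (tgt f))) => f2; last by rewrite !andbF.
  case: (leP (px (src f)) (px (src e))) => f1 /=.
    by rewrite (le_lt_trans f1 (pn_edge_lr e)) /P ltNge f1 /= andbT.
  apply/negbTE; case: (ltP (px (src f)) (px (tgt e))) => f3 //=.
  by rewrite (@abv f (src f)) /P ?f1 ?f3 //=; [rewrite andbN | left].
have stop : (\sum_(f | F f) m f = edge_rank_end e + \sum_(v | P v) d v)%N.
  rewrite -sum_by_tgt // (bigID (fun f => P (tgt f))) /= addnC.
  congr (_ + _)%N; apply: eq_bigl => f; last first.
    case Pf: (P _); rewrite ?andbF // andbT /F; case/and3P: Pf => p1 p2 p3.
    have f2 := lt_trans (pn_edge_lr f) p2.
    by rewrite p1 f2 /= (@abv f (tgt f)) ?p1 ?p2 //; right.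
  rewrite /F; case: (ltP (px (src f)) (px (tgt e))) => f2 //=.
  case: (leP (px (tgt e)) (px (tgt f))) => f1 /=.
    by rewrite (lt_le_trans (pn_edge_lr e) f1) /P [_ < px (tgt e)]ltNge f1 /= andbF /= andbT.
  apply/negbTE; case: (ltP (px (src e)) (px (tgt f))) => f3 //=.
  by rewrite (@abv f (tgt f)) /P ?f1 ?f3 //=; [rewrite andbN | right].
by apply/eqP; rewrite -(eqn_add2r (\sum_(v | P v) d v)) -start stop.
Qed.

(** The block of ranks given to [e] at its source is thus the one it has at its target, so that a
    selection of ranks is consistent along edges. *)
Lemma edge_rank_tgt e : (edge_rank e =
  vertex_rank (tgt e) + \sum_(f | (tgt f == tgt e) && (slope f < slope e)%R) m f)%N.
Proof. by rewrite edge_rank_endP edge_rank_endE. Qed.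

Section Layers.
Variable S : pred nat.

(** The paths through a vertex or an edge occupy consecutive ranks; those with rank in [S] are
    kept. *)
Definition vertex_mult v : nat := count S (iota (vertex_rank v) (d v)).
Definition edge_mult e : nat := count S (iota (edge_rank e) (m e)).

(** By [edge_rank_src], the edges leaving [v], sorted by decreasing slope, tile the ranks of [v]. *)
Lemma edge_mult_out v : ~~ is_sink v ->
  (\sum_(e | src e == v) edge_mult e = vertex_mult v)%N.
Proof.
move=> nv; have inj : {in [set e | src e == v]%SET &, injective (fun e => slope e)}.
  by move=> e f; rewrite !inE => /eqP <- /eqP fe; apply: slope_src_inj.
rewrite /vertex_mult -outflow //.
have := sum_count_rank m S (vertex_rank v) inj.
rewrite !big_set /= => <-.
apply: eq_bigr => e /eqP ev.
rewrite /edge_mult edge_rank_src ev; congr (count S (iota (_ + _) _)).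
by apply: eq_bigl => f; rewrite inE.
Qed.

Lemma edge_mult_in v : ~~ is_source v ->
  (\sum_(e | tgt e == v) edge_mult e = vertex_mult v)%N.
Proof.
move=> nv; have inj : {in [set e | tgt e == v]%SET &, injective (fun e => - slope e)}.
  (* The sign is reversed because, to the left of a common target, the edge of smaller slope is the
     higher one. *)
  move=> e f; rewrite !inE => /eqP <- /eqP fe /oppr_inj; exact: slope_tgt_inj.
rewrite /vertex_mult -inflow //.
have := sum_count_rank m S (vertex_rank v) inj.
rewrite !big_set /= => <-.
apply: eq_bigr => e /eqP ev.
rewrite /edge_mult edge_rank_tgt ev; congr (count S (iota (_ + _) _)).
by apply: eq_bigl => f; rewrite inE ltrN2.
Qed.

Lemma vertex_mult_source :
  (\sum_(v | is_source v) vertex_mult v =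
   count S (iota 0 (\sum_(v | is_source v) d v)))%N.
Proof.
have inj : {in [set v : V | is_source v]%SET &, injective (fun v => py v)}.
  move=> v w; rewrite !inE => /eqP vx /eqP wx h; apply: (@pn_pos_inj R G).
  by rewrite [pn_pos v]surjective_pairing [pn_pos w]surjective_pairing vx wx h.
have := sum_count_rank d S 0 inj.
rewrite !big_set /= => <-.
apply: eq_bigr => v sv; rewrite /vertex_mult; congr (count S (iota _ _)).
rewrite /vertex_rank (negbTE (source_not_sink sv)) rank_out_source //.
by apply: eq_bigl => w; rewrite inE.
Qed.

(* Sorting the paths pointwise by height, the union of those whose position from
   the top satisfies [S]. *)
Definition layers : graph_part G :=
  ([set v | (0 < vertex_mult v)%N]%SET, [set e | (0 < edge_mult e)%N]%SET).

Hypothesis simple : forall v, (vertex_mult v <= 1)%N.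

Lemma edge_mult_le_src e : (edge_mult e <= vertex_mult (src e))%N.
Proof.
by rewrite -edge_mult_out ?src_not_sink // (bigD1 e) //= leq_addr.
Qed.

Lemma edge_mult_le_tgt e : (edge_mult e <= vertex_mult (tgt e))%N.
Proof.
by rewrite -edge_mult_in ?tgt_not_source // (bigD1 e) //= leq_addr.
Qed.

(** As multiplicities are at most 1, the degrees in [layers] are sums of [edge_mult], and
    conservation yields the degree condition. *)
Lemma layers_multipath : is_multipath layers.
Proof.
have e1 e : (edge_mult e <= 1)%N := leq_trans (edge_mult_le_src e) (simple _).
apply/andP; split.
  apply/forall_inP => e; rewrite !inE => h.
  by rewrite (leq_trans h (edge_mult_le_src e)) (leq_trans h (edge_mult_le_tgt e)).
apply/forall_inP => v; rewrite inE => hv.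
have v1 : vertex_mult v = 1%N by apply/eqP; rewrite eqn_leq hv simple.
rewrite /degree !card_pos_mult //.
have nin : is_source v -> (\sum_(e | tgt e == v) edge_mult e = 0)%N.
  by move=> sv; rewrite big_pred0 // => e; apply: contraTF sv => /eqP<-; exact: tgt_not_source.
have nout : is_sink v -> (\sum_(e | src e == v) edge_mult e = 0)%N.
  by move=> sv; rewrite big_pred0 // => e; apply: contraTF sv => /eqP<-; exact: src_not_sink.
case: ifPn => sov; first by rewrite nin // edge_mult_out ?v1 // source_not_sink.
case: ifPn => siv; first by rewrite nout // edge_mult_in ?v1.
by rewrite edge_mult_in // edge_mult_out // v1.
Qed.

Lemma num_sources_layers :
  num_sources layers = count S (iota 0 (\sum_(v | is_source v) d v)).
Proof. by rewrite /num_sources card_pos_mult // vertex_mult_source. Qed.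

End Layers.
End Flow.

(** * Exchange between multipaths *)

Lemma count_even_iota0 n : count (predC odd) (iota 0 n) = uphalf n.
Proof.
elim: n => // n IH; rewrite -addn1 iotaD count_cat IH /= addn0 addn1 add0n.
by rewrite /= uphalf_half; case: (odd n); rewrite ?addn0 ?addn1.
Qed.

Lemma count_odd_iota0 n : count odd (iota 0 n) = n./2.
Proof.
elim: n => // n IH; rewrite -addn1 iotaD count_cat IH /= addn0 addn1 add0n.
by rewrite /= uphalf_half addnC.
Qed.

(** Two multipaths put at most two paths on a vertex, with consecutive ranks, so the layers of one
    parity are disjoint. *)
Lemma count_odd_le1 u c : (c <= 2)%N -> (count odd (iota u c) <= 1)%N.
Proof. by case: c => [|[|[|]]] //= _; case: (odd u). Qed.

Lemma count_even_le1 u c : (c <= 2)%N -> (count (predC odd) (iota u c) <= 1)%N.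
Proof. by case: c => [|[|[|]]] //= _; case: (odd u). Qed.

Section Exchange.
Variables (R : realType) (G : planar_network R) (n : nat).

Notation V := (pn_vertex G).
Notation E := (pn_edge G).
Notation src := (@pn_src R G).
Notation tgt := (@pn_tgt R G).
Notation px v := (pn_pos v).1.
Notation py v := (pn_pos v).2.

Implicit Types (e f : E) (v w : V) (p q : graph_part G).

(** At vertices outside [p] both sides vanish because [p] is a subgraph, so indicators of multipaths
    satisfy the conservation laws on the whole network. *)
Lemma multipath_in p v : is_multipath p -> ~~ is_source v ->
  (\sum_(e | tgt e == v) (e \in p.2) = (v \in p.1))%N.
Proof.
case/andP=> /forall_inP sub /forall_inP deg ns; rewrite -card_set_cond.
case: (boolP (v \in p.1)) => [vp|vp].
  by move: (deg v vp); rewrite (negbTE ns) /degree; case: ifP => _ /eqP[].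
apply/eqP; rewrite cards_eq0; apply/eqP/setP => e; rewrite !inE.
apply/negbTE; apply: contra vp => /andP[ep /eqP<-].
by case/andP: (sub e ep).
Qed.

Lemma multipath_out p v : is_multipath p -> ~~ is_sink v ->
  (\sum_(e | src e == v) (e \in p.2) = (v \in p.1))%N.
Proof.
case/andP=> /forall_inP sub /forall_inP deg ns; rewrite -card_set_cond.
case: (boolP (v \in p.1)) => [vp|vp].
  by move: (deg v vp); rewrite (negbTE ns) /degree; case: ifP => _ /eqP[].
apply/eqP; rewrite cards_eq0; apply/eqP/setP => e; rewrite !inE.
apply/negbTE; apply: contra vp => /andP[ep /eqP<-].
by case/andP: (sub e ep).
Qed.

Lemma num_sourcesE p : num_sources p = (\sum_(v | is_source v) (v \in p.1))%N.
Proof. exact: card_set_cond. Qed.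

(** A leftmost vertex that is not a source would have an incoming edge starting further left. This
    handles index 0, where [lval] is 0 by definition. *)
Lemma multipath_no_source p : is_multipath p -> num_sources p = 0%N ->
  p.2 = finset.set0.
Proof.
move=> mp /eqP; rewrite cards_eq0 => /eqP/setP nos.
have /andP[/forall_inP sub _] := mp.
apply/setP => e0; rewrite [RHS]inE; apply/negbTE/negP => e0p.
have /andP[v0p _] := sub _ e0p.
case: (arg_minP (fun v => px v) v0p) => v vp0 vmin.
have vp : v \in p.1 := vp0.
have nsv : ~~ is_source v by have := nos v; rewrite !inE vp /= => ->.
have := multipath_in mp nsv; rewrite vp => /eqP.
apply/negP; rewrite big1 // => e /eqP ev; apply/eqP; rewrite eqb0; apply/negP => ep.
have /andP[/vmin sp _] := sub _ ep.
by have := pn_edge_lr e; rewrite ev ltNge sp.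
Qed.

Lemma trunc_vertex_leq k k' v : (k <= k')%N -> trunc_vertex k v -> trunc_vertex k' v.
Proof.
move=> kk; rewrite /trunc_vertex; apply: contra => /asboolP[j jk h].
by apply/asboolP; exists j => //; exact: leq_ltn_trans jk.
Qed.

Lemma part_le_trunc p k v : part_le p (trunc G k) -> v \in p.1 -> trunc_vertex k v.
Proof. by case/andP=> /fintype.subsetP h _ /h; rewrite inE. Qed.

Lemma top_path_removal p k i : is_multipath p -> part_le p (trunc G k) ->
  num_sources p = i.+1 ->
  exists p', [/\ is_multipath p', part_le p' (trunc G k), num_sources p' = i
    & p'.2 \subset p.2].
Proof.
move=> mp pk np.
pose d v := (v \in p.1 : nat); pose m e := (e \in p.2 : nat).
have din v : ~~ is_source v -> (\sum_(e | tgt e == v) m e = d v)%N.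
  exact: multipath_in.
have dout v : ~~ is_sink v -> (\sum_(e | src e == v) m e = d v)%N.
  exact: multipath_out.
(* Every layer but the top one is kept. *)
pose S j := (0 < j)%N.
have simple v : (vertex_mult d m S v <= 1)%N.
  rewrite /vertex_mult; apply: leq_trans (count_size _ _) _.
  by rewrite size_iota /d; case: (v \in _).
have mp' := layers_multipath din dout simple.
exists (layers d m S); split=> //.
- apply: trunc_maximal; first by case/andP: mp'.
  move=> v; rewrite inE => hv; apply: (part_le_trunc pk).
  by move: hv; rewrite /vertex_mult /d; case: (v \in p.1).
- rewrite num_sources_layers // -num_sourcesE np /=.
  rewrite -[RHS](size_iota 1); apply/eqP; rewrite -all_count.
  by apply/allP => j; rewrite mem_iota => /andP[].
- apply/fintype.subsetP => e; rewrite inE /edge_mult /m.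
  by case: (e \in p.2).
Qed.

Lemma weight_mkcond (eps : E -> trop R) p :
  weight eps p = (\sum_(e : E) if e \in p.2 then trop_val (eps e) else 0)%E.
Proof. by rewrite /weight big_mkcond. Qed.

Hypothesis hG : has_rank G n.

Lemma source_height v : is_source v -> exists j : nat, py v = j%:R.
Proof.
case: hG => _ _ /seteqP[h _] _ sv.
by case: (h (py v)) => [|j _ <-]; [exists v => //=; rewrite inE | exists j].
Qed.

Lemma sink_height v : is_sink v -> exists j : nat, py v = j%:R.
Proof.
case: hG => _ _ _ /seteqP[h _] sv.
by case: (h (py v)) => [|j _ <-]; [exists v => //=; rewrite inE | exists j].
Qed.

(* Odd layers avoid rank 0, which is the only rank at which the endpoints at
   height [k.+1] can occur. *)
Lemma multipath_exchange p q k : is_multipath p -> is_multipath q ->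
  part_le p (trunc G k.+1) -> part_le q (trunc G k) ->
  exists p' q', [/\ is_multipath p', is_multipath q',
    part_le p' (trunc G k.+1), part_le q' (trunc G k) &
    [/\ num_sources p' = uphalf (num_sources p + num_sources q),
        num_sources q' = (num_sources p + num_sources q)./2 &
        forall eps, (weight eps p + weight eps q =
                     weight eps p' + weight eps q')%E]].
Proof.
move=> mp mq pk qk.
pose d v := ((v \in p.1) + (v \in q.1))%N.
pose m e := ((e \in p.2) + (e \in q.2))%N.
have din v : ~~ is_source v -> (\sum_(e | tgt e == v) m e = d v)%N.
  by move=> ns; rewrite big_split /= !multipath_in.
have dout v : ~~ is_sink v -> (\sum_(e | src e == v) m e = d v)%N.
  by move=> ns; rewrite big_split /= !multipath_out.
have d2 v : (d v <= 2)%N by rewrite /d; case: (_ \in _); case: (_ \in _).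
have m2 e : (m e <= 2)%N by rewrite /m; case: (_ \in _); case: (_ \in _).
have dk v : (0 < d v)%N -> trunc_vertex k.+1 v.
  rewrite /d; case vp: (v \in p.1) => /=; first by rewrite (part_le_trunc pk).
  case vq: (v \in q.1) => //= _.
  by apply: (trunc_vertex_leq (leqnSn k)); rewrite (part_le_trunc qk).
have se v : (vertex_mult d m (predC odd) v <= 1)%N by apply: count_even_le1.
have so v : (vertex_mult d m odd v <= 1)%N by apply: count_odd_le1.
have me := layers_multipath din dout se.
have mo := layers_multipath din dout so.
have sumd : (\sum_(v | is_source v) d v = num_sources p + num_sources q)%N.
  by rewrite big_split /= -!num_sourcesE.
exists (layers d m (predC odd)), (layers d m odd); split=> //; last split.
- apply: trunc_maximal; first by case/andP: me.
  move=> v; rewrite inE => hv; apply: dk.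
  by move: hv; rewrite /vertex_mult; case: (d v).
- apply: trunc_maximal; first by case/andP: mo.
  move=> v; rewrite inE => hv; apply/negP => /asboolP[j kj vpos].
  have dv : (0 < d v)%N by move: hv; rewrite /vertex_mult; case: (d v).
  (* The vertex lies on [p] or [q], hence in the truncation at [k.+1]. *)
  have jk : j = k.+1.
    apply/eqP; rewrite eqn_leq kj andbT leqNgt; apply/negP => kj'.
    by move/negP: (dk v dv); apply; apply/asboolP; exists j.
  (* A source or sink above [v] has height greater than [k.+1], so neither multipath uses it. *)
  have top w : (is_source w || is_sink w) -> (py v < py w) -> d w = 0%N.
    move=> sw vw; apply/eqP; rewrite -leqn0 leqNgt; apply/negP => /dk/negP; apply.
    have [i wi] : exists i : nat, py w = i%:R.
      by case/orP: sw; [exact: source_height | exact: sink_height].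
    apply/asboolP; exists i.
      move: vw; rewrite wi; case: vpos => -> /=; rewrite ltr_nat jk //.
    rewrite [pn_pos w]surjective_pairing -wi.
    by case/orP: sw => /eqP ->; [left | right].
  have r0 : vertex_rank m v = 0%N.
    rewrite /vertex_rank; case: ifP => sv.
      rewrite (rank_in_sink din) // big1 // => w /andP[sw]; apply: top.
      by rewrite sw orbT.
    have sov : is_source v.
      by case: vpos => vp; [| move: sv]; rewrite /is_source /is_sink vp eqxx.
    rewrite (rank_out_source dout) // big1 // => w /andP[sw]; apply: top.
    by rewrite sw.
  (* Only [p] can pass through [v], so [v] occupies rank 0 alone, which is not odd. *)
  have vq : v \notin q.1.
    apply/negP => /(part_le_trunc qk)/negP; apply; apply/asboolP.
    by exists j.
  have d1 : (d v <= 1)%N by rewrite /d (negbTE vq) addn0; case: (_ \in _).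
  by move: hv; rewrite /vertex_mult r0; case: (d v) d1 => [|[|]].
- by rewrite num_sources_layers // sumd count_even_iota0.
- by rewrite num_sources_layers // sumd count_odd_iota0.
- move=> eps; rewrite !weight_mkcond -!big_split /=; apply: eq_bigr => e _.
  (* Each rank has exactly one parity, so every edge is used as often after sorting as before. *)
  have sume : (edge_mult m (predC odd) e + edge_mult m odd e = m e)%N.
    by rewrite /edge_mult addnC count_predC size_iota.
  have e1 : (edge_mult m (predC odd) e <= 1)%N by apply: count_even_le1.
  have e2 : (edge_mult m odd e <= 1)%N by apply: count_odd_le1.
  rewrite !inE; move: sume e1 e2; rewrite /m.
  case: (edge_mult _ _ _) => [|[|]] //; case: (edge_mult _ _ _) => [|[|]] //;
    by case: (e \in p.2); case: (e \in q.2) => // _ _ _; rewrite addeC.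
Qed.

Lemma lval_ge (eps : E -> trop R) k i p : p \in kpaths (trunc G k) i ->
  (weight eps p <= lval (trunc G k) i eps)%E.
Proof.
move=> pk; rewrite /lval; case: eqP => [i0|_].
  move: pk; rewrite inE i0 => /and3P[mp _ /eqP np].
  by rewrite /weight (multipath_no_source mp np) big_set0.
exact: le_bigmax_cond.
Qed.

Lemma lval_attained (eps : E -> trop R) k i :
  lval (trunc G k) i eps = -oo%E \/
  exists2 p, p \in kpaths (trunc G k) i & lval (trunc G k) i eps = weight eps p.
Proof.
rewrite /lval; case: eqP => [->|_].
  right; exists (finset.set0, finset.set0); last by rewrite /weight big_set0.
  rewrite inE; apply/and3P; split.
  - by apply/andP; split; apply/forall_inP => v; rewrite inE.
  - by rewrite /part_le !finset.sub0set.
  - by rewrite cards_eq0; apply/eqP/setP => v; rewrite !inE.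
elim/big_rec: _ => [|p x pk IH]; first by left.
rewrite /Order.max; case: ifP => // _.
by right; exists p.
Qed.

(** Exchanging maximizers. The pairs [(i, i.+1)] and [(i.+2, i)] become [(i.+1, i)] and
    [(i.+1, i.+1)], giving the two families of inequalities. *)
Lemma lval_exchange (eps : E -> trop R) k i j :
  (lval (trunc G k.+1) i eps + lval (trunc G k) j eps <=
   lval (trunc G k.+1) (uphalf (i + j)) eps + lval (trunc G k) (i + j)./2 eps)%E.
Proof.
case: (lval_attained eps k.+1 i) => [->|[p]]; first by rewrite leNye.
case: (lval_attained eps k j) => [->|[q]]; first by rewrite addeNy leNye.
rewrite !inE => /and3P[mq qk /eqP nq] -> /and3P[mp pk /eqP np] ->.
have [p' [q' [mp' mq' pk' qk' [np' nq' ->]]]] := multipath_exchange mp mq pk qk.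
apply: leeD; apply: lval_ge; rewrite inE.
  by rewrite mp' pk' np' np nq /=.
by rewrite mq' qk' nq' np nq /=.
Qed.

(** A weight is [-oo] only if some edge has weight [-oo], and removing the top path adds no edge. *)
Lemma lval_finite_pred (eps : E -> trop R) k i :
  lval (trunc G k) i.+1 eps != -oo%E -> lval (trunc G k) i eps != -oo%E.
Proof.
case: (lval_attained eps k i.+1) => [->//|[p]].
rewrite inE => /and3P[mp pk /eqP np] -> wp.
have [p' [mp' pk' np' sub]] := top_path_removal mp pk np.
have /lval_ge-/(_ eps) : p' \in kpaths (trunc G k) i by rewrite inE mp' pk' np' /=.
rewrite -!ltNye; apply: lt_le_trans; rewrite ltNye.
apply: contra wp => /eqP/esum_eqNyP[e [_ ep' e0]]; apply/eqP/esum_eqNyP.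
exists e; split=> //; exact: (fintype.subsetP sub).
Qed.

End Exchange.

(** * Closure of the Gelfand-Tsetlin cone *)

Lemma closure_of_cvg (T : topologicalType) (A : set T) (u : nat -> T) (l : T) :
  (forall N, A (u N)) -> u @ \oo --> l -> closure A l.
Proof.
move=> Au ul B /ul [N _ hN].
by exists (u N); split => //; apply: hN; rewrite /= leqnn.
Qed.

Lemma cvg_initial (S : choiceType) (T : topologicalType) (f : S -> T)
    (u : nat -> S) (l : S) :
  f \o u @ \oo --> f l -> u @ \oo --> (l : initial_topology f).
Proof.
move=> fu B /= [_ [[C Cop <-] Cl sub]].
have /fu : nbhs (f l) C by apply: open_nbhs_nbhs.
move=> fC; have {}fC : \forall N \near \oo, C (f (u N)) := fC.
by change (\forall N \near \oo, B (u N)); apply: filterS fC => N; exact: sub.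
Qed.

(** The topology comes from the projections followed by the inclusion into [\bar R], so convergence
    is checked there coordinate by coordinate. *)
Lemma cvg_tropVT (R : realType) (n : nat) (u : nat -> tropVT R n) (l : tropVT R n) :
  (forall p, (fun N => trop_val (u N p)) @ \oo --> trop_val (l p)) ->
  u @ \oo --> l.
Proof.
move=> h; apply/cvg_sup => p; apply: (@cvg_initial _ _ (fun t : tropVT R n => t p)).
apply: (@cvg_initial _ _ (set_val : trop R -> \bar R)); exact: h.
Qed.

Section Cone.
Variables (R : realType) (n : nat) (t : nat -> nat -> \bar R).
Hypothesis t_lty : forall k i, (t k i < +oo)%E.
Hypothesis t0 : forall k, t k 0%N = 0%E.
Hypothesis t_pred : forall k i, t k i.+1 != -oo%E -> t k i != -oo%E.
Hypothesis t_left : forall k i, (i < k)%N -> (k < n)%N ->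
  (t k.+1 i + t k i.+1 <= t k.+1 i.+1 + t k i)%E.
Hypothesis t_right : forall k i, (i < k)%N -> (k < n)%N ->
  (t k.+1 i.+2 + t k i <= t k.+1 i.+1 + t k i.+1)%E.

Let fineT k i : t k i != -oo%E -> t k i \is a fin_num.
Proof. by move=> h; rewrite fin_numE h lt_eqF. Qed.

(** Induction on [i]: were the new entry [-oo], so would be the larger side of [t_left], whose
    smaller side is finite. [t_pred_diag] uses [t_right] in the same way. *)
Lemma t_succ_row k i : (i <= k)%N -> (k < n)%N ->
  t k i != -oo%E -> t k.+1 i != -oo%E.
Proof.
move=> + kn; elim: i => [|i IH] ik hi; first by rewrite t0.
have h1 := t_pred hi; have h2 := IH (ltnW ik) h1.
apply: contraTneq (t_left ik kn) => ->; rewrite addNye -ltNge ltNye.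
by rewrite adde_eq_ninfty negb_or h2.
Qed.

Lemma t_pred_diag k i : (i <= k)%N -> (k < n)%N ->
  t k.+1 i.+1 != -oo%E -> t k i != -oo%E.
Proof.
move=> + kn; elim: i => [|i IH] ik hi; first by rewrite t0.
have h2 := IH (ltnW ik) (t_pred hi).
apply: contraTneq (t_right ik kn) => ->; rewrite addeNy -ltNge ltNye.
by rewrite adde_eq_ninfty negb_or hi.
Qed.

Definition gt_step k i : R := fine (t k i.+1) - fine (t k i).

(* Entries of a Gelfand-Tsetlin pattern; cutting them off from below by a
   common constant preserves the interlacing inequalities. *)
Definition gt_cut (N : nat) k i : R :=
  if t k i.+1 == -oo%E then - N%:R else Num.max (gt_step k i) (- N%:R).

Definition gt_sum N k i : R := \sum_(j < i) gt_cut N k j.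

Lemma gt_cut_ge N k i : - N%:R <= gt_cut N k i.
Proof. by rewrite /gt_cut; case: ifP => // _; rewrite le_max lexx orbT. Qed.

(** An infinite entry on the smaller side is cut to the least possible value [- N%:R]; a finite one
    forces all four terms of [t_left] to be finite. *)
Lemma gt_cut_left N k i : (i < k)%N -> (k < n)%N ->
  gt_cut N k i <= gt_cut N k.+1 i.
Proof.
move=> ik kn; rewrite {1}/gt_cut; case: ifPn => h; first exact: gt_cut_ge.
have h1 := t_succ_row ik kn h.
rewrite /gt_cut (negbTE h1) ge_max !le_max lexx !orbT andbT.
apply/orP; left; have := t_left ik kn.
rewrite /gt_step.
have := fineT h; have := fineT h1; have := fineT (t_pred h); have := fineT (t_pred h1).
case: (t k i.+1) => [a||] //; case: (t k i) => [b||] //.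
case: (t k.+1 i) => [c||] //; case: (t k.+1 i.+1) => [e||] //= _ _ _ _.
by rewrite -!EFinD lee_fin; lra.
Qed.

Lemma gt_cut_right N k i : (i < k)%N -> (k < n)%N ->
  gt_cut N k.+1 i.+1 <= gt_cut N k i.
Proof.
move=> ik kn; rewrite {1}/gt_cut; case: ifPn => h; first exact: gt_cut_ge.
have h1 := t_pred_diag ik kn h.
rewrite /gt_cut (negbTE h1) ge_max !le_max lexx !orbT andbT.
apply/orP; left; have := t_right ik kn.
rewrite /gt_step.
have := fineT h; have := fineT h1; have := fineT (t_pred h); have := fineT (t_pred h1).
case: (t k i.+1) => [a||] //; case: (t k i) => [b||] //.
case: (t k.+1 i.+1) => [c||] //; case: (t k.+1 i.+2) => [e||] //= _ _ _ _.
by rewrite -!EFinD lee_fin; lra.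
Qed.

Lemma gt_sumS N k i : gt_sum N k i.+1 = gt_sum N k i + gt_cut N k i.
Proof. by rewrite /gt_sum big_ord_recr. Qed.

Definition gt_point N : VT n -> R := fun p => gt_sum N (val p).1 (val p).2.

Lemma coord_gt_point N k i : (i <= k <= n)%N ->
  Defs.coord (gt_point N) k i = gt_sum N k i.
Proof. by move=> h; rewrite /Defs.coord insubT /= /gt_point. Qed.

Lemma gt_point_cone2 N : cone2 (gt_point N).
Proof.
move=> k [//|i] _ ik kn /=.
have kn' := ltnW kn; have ik' := ltnW ik.
rewrite !coord_gt_point ?kn ?kn' ?ik ?ik' ?ltnS ?andbT //; last by rewrite leqW.
rewrite !gt_sumS; have := gt_cut_left N ik kn; have := gt_cut_right N ik kn.
by move=> ? ?; split; lra.
Qed.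

Lemma gt_sum_cvg k i : (fun N => (gt_sum N k i)%:E) @ \oo --> t k i.
Proof.
case: (boolP (t k i == -oo%E)) => h.
  rewrite (eqP h); case: i h => [|i] h; first by rewrite t0 in h.
  apply/cvgeNyPle => A.
  (* The last entry is exactly [- N%:R], and the others are bounded above by their positive parts,
     uniformly in [N]. *)
  pose C : R := \sum_(j < i) Num.max (gt_step k j) 0.
  have bound N : gt_sum N k i.+1 <= C - N%:R.
    rewrite gt_sumS {1}/gt_cut h lerD2r; apply: ler_sum => j _.
    rewrite /gt_cut; case: ifP => _; first by rewrite le_max oppr_le0 ler0n orbT.
    by rewrite ge_max !le_max lexx oppr_le0 ler0n orbT.
  near=> N; rewrite lee_fin; apply: le_trans (bound N) _.
  rewrite lerBlDl -lerBlDr; near: N; exact: nbhs_infty_ger.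
have hj j : (j <= i)%N -> t k j != -oo%E.
  elim: i h => [|i IH] h; first by rewrite leqn0 => /eqP->.
  rewrite leq_eqVlt => /orP[/eqP->//|]; rewrite ltnS.
  by apply: IH; exact: t_pred.
have tel j : (j <= i)%N -> \sum_(l < j) gt_step k l = fine (t k j).
  elim: j => [|j IH] ji; first by rewrite big_ord0 t0.
  by rewrite big_ord_recr /= (IH (ltnW ji)) /gt_step addrC subrK.
apply: cvg_near_cst.
(* Once [N] exceeds [M] no entry is cut, and the sum telescopes to [t k i]. *)
pose M : R := \sum_(j < i) `|gt_step k j|.
near=> N; rewrite -(fineK (fineT h)) -tel //; congr (_%:E).
apply: eq_bigr => j _; rewrite /gt_cut (negbTE (hj _ _)) //; apply/max_idPl.
rewrite lerNl; apply: le_trans (ler_norm _) _; rewrite normrN.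
apply: (@le_trans _ _ M); first by rewrite /M (bigD1 j) //= lerDl sumr_ge0.
by near: N; exact: nbhs_infty_ger.
Unshelve. all: by end_near.
Qed.

Lemma closure_cone2 (l : tropVT R n) :
  (forall p, trop_val (l p) = t (val p).1 (val p).2) ->
  closure (@trop_embed R n @` @cone2 R n) l.
Proof.
move=> hl; apply: (@closure_of_cvg _ _ (fun N => trop_embed (gt_point N))).
  by move=> N; exists (gt_point N) => //; exact: gt_point_cone2.
by apply: cvg_tropVT => p; rewrite hl; exact: gt_sum_cvg.
Qed.

End Cone.

Theorem theorem4p1 (R : realType) (n : nat) (G : planar_network R)
    (hG : has_rank G n) :
  range (@Lmap R n G)
    `<=` closure (@trop_embed R n @` @cone2 R n) `&` @zero_section R n.
Proof.
move=> _ [eps _ <-]; split.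
  apply: (@closure_cone2 _ _ (fun k i => lval (trunc G k) i eps)) => //.
  - by move=> k i; exact: lval_lty.
  - by move=> k i; exact: lval_finite_pred.
  - move=> k i _ _; have := lval_exchange hG eps k i i.+1.
    by rewrite addnS addnn /= uphalf_double doubleK.
  - move=> k i _ _; have := lval_exchange hG eps k i.+2 i.
    by rewrite !addSn addnn /= uphalf_double doubleK.
by move=> p p0; apply: val_inj; rewrite /= p0.
Qed.
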